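(* Let $H\in\mathbb R[Q(V)]$ be a homogeneous $Q(V)^+$-Gårding polynomial of degree $d\ge1$, and for each complex subspace $U\subseteq V$ let $r_H(U):=\deg_tH(I+t\pi_U)$, where $\pi_U$ is the $\rho$-orthogonal projection onto $U$. Then $\mathcal P_H:=(V,r_H)$ is an integral subspace polymatroid.
   Context: $V$ is a complex vector space of dimension $n$ with a fixed positive definite Hermitian form $\rho$; $Q(V)$ is the real vector space of Hermitian forms on $V$, identified via $\rho$ with $\rho$-self-adjoint endomorphisms (so $\rho$ corresponds to $I$ and $\pi_U$ is an element of $Q(V)^+$, the cone of semipositive forms). Subspace polymatroid on $V$: a pair $(V,r)$, $r$ a function from the lattice of complex subspaces of $V$ to $\mathbb R_{\ge0}$, such that for all subspaces $U,W$: $r(\{0\})=0$; $U\subseteq W$ implies $r(U)\le r(W)$; and $r(U)+r(W)\ge r(U\cap W)+r(U+W)$. It is integral if $r$ is integer-valued. $\mathcal K$-Gårding: let $W$ be a finite-dimensional real vector space and $\mathcal K\subsetneq W$ a closed convex cone with nonempty interior. A set $\mathcal U\subseteq W$ satisfies the $\mathcal K$-conic ray test if $\mathcal U+\mathcal K\subseteq\mathcal U$. For nonzero $F\in\mathbb R[W]$, $\{F>0\}$ has at most one connected component satisfying this test; if it exists it is denoted $\mathcal C_F^{\mathcal K}$ (for a positive constant, $\mathcal C_F^{\mathcal K}=W$). A nonzero $F$ is $\mathcal K$-Gårding (recursively on degree) if $\mathcal C_F^{\mathcal K}$ exists and, whenever $\deg F\ge1$, for every $P\in\mathcal K$ with $\partial_PF\not\equiv0$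 the directional derivative $\partial_PF$ is $\mathcal K$-Gårding and $\mathcal C_F^{\mathcal K}\subseteq\mathcal C_{\partial_PF}^{\mathcal K}$. *)

(* Defs.v *)
From HB Require Import structures.
From mathcomp Require Import all_boot all_order all_algebra.
From mathcomp Require Import sesquilinear complex.
From mathcomp Require Import all_classical all_reals all_analysis.
(* Without its notations, which clash with those of mathcomp-analysis. *)
From mathcomp Require Import -(notations) mpoly.

Set Implicit Arguments.
Unset Strict Implicit.
Unset Printing Implicit Defensive.

Import Order.TTheory GRing.Theory Num.Theory.
Import numFieldNormedType.Exports.

Local Open Scope classical_set_scope.
Local Open Scope ring_scope.

Section Polynomials.
Variables (R : realType) (W : vectType R).

Definition coords (w : W) : 'rV[R]_(\dim {:W}) :=
  \row_i coord (vbasis {:W}) i w.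

(* The ring R[W]: polynomials in the coordinates of a basis of W. *)
Definition polyring := mpoly (\dim {:W}) R.

Definition peval (F : polyring) (w : W) : R :=
  meval (fun i => coords w 0 i) F.

(* Total degree; degenerates to 0 on the zero polynomial. *)
Definition pdegree (F : polyring) : nat :=
  (mmeasure (@mdeg _) F).-1.

Definition phomogeneous (d : nat) (F : polyring) : Prop :=
  F \is ishomog1 d (@mdeg _).

Definition dirderiv (P : W) (F : polyring) : polyring :=
  \sum_i coords P 0 i *: mderiv i F.

(* F(A + tB) as a polynomial in t. *)
Definition line_poly (F : polyring) (A B : W) : {poly R} :=
  mmap (@polyC R) (fun i => (coords A 0 i)%:P + coords B 0 i *: 'X) F.

Lemma line_polyE F A B t : (line_poly F A B).[t] = peval F (A + t *: B).
Proof.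
rewrite /line_poly /peval /meval /mmap horner_sum.
apply: eq_bigr => m _; rewrite hornerM hornerC; congr (_ * _).
rewrite /mmap1 horner_prod; apply: eq_bigr => i _.
by rewrite horner_exp !hornerE !mxE linearD linearZ /= [t * _]mulrC.
Qed.

End Polynomials.

(* K stands for a closed convex cone with nonempty interior, K <> W. *)
Section Garding.
Variables (R : realType) (W : vectType R) (K : set W).
Implicit Types (F : polyring W) (U C : set W).

Definition conic_ray_test U : Prop := forall u k, U u -> K k -> U (u + k).

Definition positivity_set F : set W := [set w | 0 < peval F w].

(* C is a connected component of A, for the topology of W transported from
   'rV[R]_(\dim W) by the coordinates. *)
Definition is_component (A C : set W) : Prop :=
  exists2 w, A w &
    C = @coords R W @^-1` connected_component (@coords R W @` A) (coords w).

Definition is_conic_component F C : Prop :=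
  is_component (positivity_set F) C /\ conic_ray_test C.

Definition has_conic_component F : Prop := exists C, is_conic_component F C.

(* The component C_F^K: unique when it exists, provided that K has nonempty
   interior; an arbitrary default when there is none. *)
Definition conic_component F : set W := get (is_conic_component F).

(* The recursion on the degree is well founded, as dF/dP has smaller degree
   than F. *)
Inductive garding F : Prop := Garding of
    F != 0
  & has_conic_component F
  & ((1 <= pdegree F)%N -> forall P, K P -> dirderiv P F != 0 ->
       garding (dirderiv P F))
  & ((1 <= pdegree F)%N -> forall P, K P -> dirderiv P F != 0 ->
       conic_component F `<=` conic_component (dirderiv P F)).

End Garding.

Definition realification (R : realType) (V : vectType R[i]) : Type := V.

Section Realification.
Variables (R : realType) (V : vectType R[i]).
Local Notation VR := (realification V).

HB.instance Definition _ := GRing.Zmodule.on VR.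

Definition rscale (a : R) (v : VR) : VR := (a%:C)%C *: (v : V).

Fact rscaleA a b v : rscale a (rscale b v) = rscale (a * b) v.
Proof. by rewrite /rscale scalerA rmorphM. Qed.
Fact rscale1 : left_id 1 rscale.
Proof. by move=> v; rewrite /rscale rmorph1 scale1r. Qed.
Fact rscaleDr : right_distributive rscale +%R.
Proof. by move=> a u v; rewrite /rscale scalerDr. Qed.
Fact rscaleDl v : {morph rscale^~ v : a b / a + b}.
Proof. by move=> a b; rewrite /rscale rmorphD scalerDl. Qed.

HB.instance Definition _ :=
  GRing.Zmodule_isLmodule.Build R VR rscaleA rscale1 rscaleDr rscaleDl.

Let n := \dim {:V}.
Let b := vbasis {:V}.

Let to_rV (v : VR) : 'rV[R]_(n + n) :=
  row_mx (\row_i complex.Re (coord b i v)) (\row_i complex.Im (coord b i v)).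
Let of_rV (r : 'rV[R]_(n + n)) : VR :=
  \sum_(i < n) Complex (lsubmx r 0 i) (rsubmx r 0 i) *: (b`_i : V).

Fact realification_vect : Vector.axiom (n + n) VR.
Proof.
exists to_rV.
  move=> a u v; rewrite /to_rV scale_row_mx add_row_mx.
  have coordE i : coord b i (a *: u + v : VR) =
      (a%:C)%C * coord b i (u : V) + coord b i (v : V).
    by rewrite linearD linearZ.
  congr row_mx; apply/rowP => i; rewrite !mxE coordE.
    by case: (coord _ _ _) => x y; case: (coord _ _ _) => z t /=; rewrite mul0r subr0.
  by case: (coord _ _ _) => x y; case: (coord _ _ _) => z t /=; rewrite mul0r addr0.
exists of_rV => [v | r]; rewrite /of_rV /to_rV.
  rewrite row_mxKl row_mxKr [RHS](coord_vbasis (memvf (v : V))).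
  by apply: eq_bigr => i _; rewrite !mxE; case: (coord _ _ _).
have bfree : free b by apply: basis_free (vbasisP _).
rewrite -[RHS]hsubmxK.
congr row_mx; apply/rowP => i; rewrite mxE.
  by rewrite (coord_sum_free _ _ bfree).
by rewrite (coord_sum_free _ _ bfree).
Qed.

HB.instance Definition _ := Lmodule_hasFinDim.Build R VR realification_vect.

End Realification.

Section HermitianForms.
Variables (R : realType) (V : vectType R[i]) (rho : {dot V for @Num.conj R[i]}).

Definition selfadjoint (f : 'End(V)) : Prop :=
  forall x y, rho (f x) y = rho x (f y).

Local Notation EndR := (realification 'End(V)).
Let n := \dim {:V}.
Let b := vbasis {:V}.

Definition selfadj_defect (f : EndR) : realification 'M[R[i]]_n :=
  \matrix_(i, j) (rho ((f : 'End(V)) b`_i) b`_j - rho b`_i ((f : 'End(V)) b`_j)).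

Fact selfadj_defect_linear : linear selfadj_defect.
Proof.
move=> a f g; apply/matrixP => i j.
have lE x : ((a *: f + g : EndR) : 'End(V)) x =
    (a%:C)%C *: (f : 'End(V)) x + (g : 'End(V)) x.
  by rewrite add_lfunE scale_lfunE.
rewrite !mxE !lE linearDl linearDr linearZl_LR linearZr_LR /=.
have -> : ((a%:C)%C)^* = (a%:C)%C by exact: conjc_real.
by rewrite mulrBr opprD addrACA.
Qed.

HB.instance Definition _ :=
  GRing.isLinear.Build R EndR (realification 'M[R[i]]_n) *:%R
    selfadj_defect selfadj_defect_linear.

(* The Hermitian form x, y |-> rho (f x) y is represented by the selfadjoint
   endomorphism f; see mem_herm_space. *)
Definition herm_space : {vspace EndR} := lker (linfun selfadj_defect).

Lemma mem_herm_space (f : 'End(V)) :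
  (f : EndR) \in herm_space <-> selfadjoint f.
Proof.
rewrite memv_ker lfunE /=; split => [/eqP/matrixP f0 x y | fP].
  have f0' (i j : 'I_n) : rho (f b`_i) b`_j = rho b`_i (f b`_j).
    by apply/eqP; rewrite -subr_eq0; have := f0 i j; rewrite !mxE => ->.
  have fS z : f z = \sum_(i < n) coord b i z *: f b`_i.
    rewrite {1}(coord_vbasis (memvf z)) linear_sum.
    by apply: eq_bigr => i _; rewrite linearZ.
  have f1 (j : 'I_n) : rho (f x) b`_j = rho x (f b`_j).
    rewrite fS {2}(coord_vbasis (memvf x)) !linear_sumlz.
    by apply: eq_bigr => i _; rewrite !linearZl_LR /= f0'.
  rewrite (fS y) {1}(coord_vbasis (memvf y)) !linear_sumr.
  by apply: eq_bigr => j _; rewrite !linearZr_LR /= f1.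
by apply/eqP/matrixP => i j; rewrite !mxE fP subrr.
Qed.

Definition Q := subvs_of herm_space.

Definition Q_endo (A : Q) : 'End(V) := vsval A.

Definition Q_of (f : 'End(V)) (fP : selfadjoint f) : Q :=
  Subvs (proj2 (mem_herm_space f) fP).

Definition Qplus : set Q := [set A | forall x, 0 <= rho (Q_endo A x) x].

Lemma selfadjoint_id : selfadjoint \1%VF.
Proof. by move=> x y; rewrite !id_lfunE. Qed.

Definition orthoproj (U : {vspace V}) : 'End(V) := daddv_pi U (orthov rho U).

Lemma capv_orthov U : (U :&: orthov rho U = 0)%VS.
Proof.
apply/eqP; rewrite -subv0; apply/subvP => u; rewrite memv_cap => /andP[uU].
by move=> /mem_orthovP /(_ u uU)/eqP; rewrite dnorm_eq0 memv0.
Qed.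

Lemma addv_orthov U : (U + orthov rho U = fullv)%VS.
Proof.
apply/eqP; rewrite eqEsubv subvf; apply/subvP => x _.
have [y yU [z [-> _ zU]]] := orthogonal_split rho (vbasis U) x.
rewrite (span_basis (vbasisP U)) in yU.
apply: memv_add => //; apply/mem_orthovP => v vU.
rewrite orthogonalE (span_basis (vbasisP U)) in zU.
by move/orthovP: zU; apply => //; rewrite memv_span1.
Qed.

Lemma selfadjoint_orthoproj U : selfadjoint (orthoproj U).
Proof.
move=> x y; rewrite /orthoproj.
have dec w : daddv_pi U (orthov rho U) w + daddv_pi (orthov rho U) U w = w.
  by apply: daddv_pi_add; rewrite ?capv_orthov // addv_orthov memvf.
have o1 u v : u \in U -> v \in orthov rho U -> rho v u = 0.
  by move=> uU /mem_orthovP; apply.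
have o2 u v : u \in U -> v \in orthov rho U -> rho u v = 0.
  by move=> uU vU; apply/eqP; rewrite herm_eq0C; apply/eqP/o1.
have pU w : daddv_pi U (orthov rho U) w \in U by apply: memv_pi.
have qU w : daddv_pi (orthov rho U) U w \in orthov rho U by apply: memv_pi.
have dr u v w : rho u w = 0 -> rho u (v + w) = rho u v.
  by move=> uw; rewrite linearDr /= uw addr0.
have dl u v w : rho w u = 0 -> rho (v + w) u = rho v u.
  by move=> uw; rewrite linearDl /= uw addr0.
transitivity (rho (daddv_pi U (orthov rho U) x) (daddv_pi U (orthov rho U) y)).
  rewrite -[in LHS](dec y); apply: dr; apply: o2; [exact: pU | exact: qU].
rewrite -[in RHS](dec x); apply/esym/dl; apply: o1; [exact: pU | exact: qU].
Qed.

Definition QI : Q := Q_of selfadjoint_id.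
Definition Qpi (U : {vspace V}) : Q := Q_of (selfadjoint_orthoproj U).

(* The degree in t of H(I + t pi_U). The zero polynomial gets degree -1, so
   that nonnegativity of this function carries H(I + t pi_U) != 0. *)
Definition rank_fun (H : polyring Q) (U : {vspace V}) : R :=
  (size (line_poly H QI (Qpi U)))%:R - 1.

End HermitianForms.

Section Polymatroid.
Variables (R : realType) (V : vectType R[i]).

Record subspace_polymatroid (r : {vspace V} -> R) : Prop := {
  spoly_ge0 : forall U, 0 <= r U;
  spoly0 : r 0%VS = 0;
  spoly_mono : forall U W, (U <= W)%VS -> r U <= r W;
  spoly_submod : forall U W, r U + r W >= r (U :&: W)%VS + r (U + W)%VS }.

Definition integral_polymatroid (r : {vspace V} -> R) : Prop :=
  subspace_polymatroid r /\ forall U, r U \is a Num.int.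

End Polymatroid.

(* Main.v *)
Require Import Defs.
From HB Require Import structures.
From mathcomp Require Import all_boot all_order all_algebra.
From mathcomp Require Import sesquilinear complex.
From mathcomp Require Import all_classical all_reals all_analysis.
From mathcomp Require Import polyorder zify ring lra.
From mathcomp Require Import -(notations) mpoly.

(** Write K for the cone Q(V)^+, D_P for the derivative along P, and e for the
form I, an order unit of K: every A satisfies A <= c e for some c > 0.

Positivity.  If F is homogeneous and K-Garding, its conic component contains
some u, hence also s e = u + (s e - u) for large s, hence the whole open ray
through e; so F(e) > 0.  Derivatives of F along K are zero or again homogeneous
and K-Garding, hence nonnegative at e.  It follows that the degree of
F(e + t P) is the largest k with D_P^k F <> 0 ([size_line_poly]), and that
D_P F <> 0 forces D_B F <> 0 as soon as P <= c B ([dirderiv_dominated]).  In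
particular the degree is monotone in P, and depends on P only up to mutual
domination.

Exchange.  The inclusion of the component of F in that of D_A F is what makes
the degree submodular, through one local step ([dirderiv_exchange]): if
D_A F <> 0 and D_B^(n+1) F <> 0 then D_B^n D_A F <> 0.  Differentiating along e
one may suppose that F has degree n + 1; then D_B^(n+1) F <> 0 means F(B) > 0 by
Euler's identity, so B lies in the component of F (joined to it by the segment
from B + e to B), so D_A F is positive at B, which by Euler's identity again is
D_B^n D_A F <> 0.

Submodularity.  Iterating the exchange with A = pi_(U cap W) and
B = pi_U + pi_W, of degrees m = r(U cap W) and n = r(U + W) (the form
pi_U + pi_W and the projection onto U + W dominate each other up to constants),
gives (D_(pi_U) + D_(pi_W))^(n-m) D_A^m F <> 0.  Expanding, there are j + k = n - m
with D_(pi_U)^j D_A^m F <> 0 and D_(pi_W)^k D_A^m F <> 0.  As A <= pi_U and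
A <= pi_W, this says r(U) >= m + j and r(W) >= m + k, whose sum is m + n. *)

Set Implicit Arguments.
Unset Strict Implicit.
Unset Printing Implicit Defensive.

Import Order.TTheory GRing.Theory Num.Theory.
Import numFieldNormedType.Exports.
Local Open Scope ring_scope.

(** * Directional derivatives of polynomials *)

Section Calculus.
Variables (R : realType) (W : vectType R).
Implicit Types (F G : polyring W) (A B P : W).

Lemma dirderivDl P B F : dirderiv (P + B) F = dirderiv P F + dirderiv B F.
Proof.
rewrite /dirderiv -big_split; apply: eq_bigr => i _ /=.
by rewrite !mxE linearD scalerDl.
Qed.

Lemma dirderivZl c P F : dirderiv (c *: P) F = c *: dirderiv P F.
Proof.
rewrite /dirderiv scaler_sumr; apply: eq_bigr => i _.
by rewrite !mxE linearZ /= scalerA.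
Qed.

Lemma dirderivDr P F G : dirderiv P (F + G) = dirderiv P F + dirderiv P G.
Proof.
rewrite /dirderiv -big_split; apply: eq_bigr => i _ /=.
by rewrite mderivD scalerDr.
Qed.

Lemma dirderivZr P c F : dirderiv P (c *: F) = c *: dirderiv P F.
Proof.
rewrite /dirderiv scaler_sumr; apply: eq_bigr => i _.
by rewrite mderivZ !scalerA mulrC.
Qed.

Lemma dirderiv0 P : dirderiv P (0 : polyring W) = 0.
Proof. by rewrite -[X in dirderiv P X](scale0r 0) dirderivZr scale0r. Qed.

Lemma dirderivC P B F : dirderiv P (dirderiv B F) = dirderiv B (dirderiv P F).
Proof.
have E X Y : dirderiv X (dirderiv Y F) =
    \sum_i \sum_j (coords X 0 i * coords Y 0 j) *: mderiv i (mderiv j F).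
  rewrite /dirderiv; apply: eq_bigr => i _.
  rewrite (raddf_sum (mderiv i)) scaler_sumr; apply: eq_bigr => j _.
  by rewrite /= mderivZ scalerA.
rewrite !E exchange_big; apply: eq_bigr => i _; apply: eq_bigr => j _.
by rewrite mulrC mderiv_comm.
Qed.

Lemma dirderivM P F G :
  dirderiv P (F * G) = dirderiv P F * G + F * dirderiv P G.
Proof.
rewrite /dirderiv mulr_suml mulr_sumr -big_split; apply: eq_bigr => i _ /=.
by rewrite mderivM scalerDr scalerAl scalerAr.
Qed.


Lemma dirderiv_homog d P F :
  phomogeneous d F -> phomogeneous d.-1 (dirderiv P F).
Proof.
rewrite /phomogeneous => hF; apply: rpred_sum => i _; apply: dhomogZ.
apply/dhomogP => m; rewrite mcoeff_msupp mcoeff_mderiv => nz.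
suff /(dhomog_mf hF) <- : mnm_add m (mnm1 i) \in msupp F.
  by rewrite /= mdegD mdeg1 addn1.
by rewrite mcoeff_msupp; apply: contraNneq nz => ->; rewrite mul0rn.
Qed.

Lemma dirderiv_homog0 P F : phomogeneous 0 F -> dirderiv P F = 0.
Proof.
move=> hF; rewrite /dirderiv big1 // => i _.
suff -> : mderiv i F = 0 by rewrite scaler0.
apply/mpolyP => m; rewrite mcoeff0 mcoeff_mderiv (dhomog_nemf_coeff hF) ?mul0rn //.
by rewrite /= mdegD mdeg1 addn1.
Qed.

Lemma peval_homog0 A B F : phomogeneous 0 F -> peval F A = peval F B.
Proof.
move=> hF; rewrite /peval !mevalE; apply: eq_big_seq => m /(dhomog_mf hF)/eqP.
rewrite /= mdeg_eq0 => /eqP ->; congr (_ * _).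
by apply: eq_bigr => i _; rewrite !mnm0E !expr0.
Qed.

Lemma peval_scale d t B F :
  phomogeneous d F -> peval F (t *: B) = t ^+ d * peval F B.
Proof.
move=> hF; rewrite /peval !mevalE mulr_sumr; apply: eq_big_seq => m mF.
rewrite mulrCA -(dhomog_mf hF mF) /= mdegE expr_sum -big_split /=.
congr (_ * _); apply: eq_bigr => i _.
by rewrite !mxE linearZ /= exprMn.
Qed.

Lemma pevalD F G A : peval (F + G) A = peval F A + peval G A.
Proof. exact: mevalD. Qed.

Lemma pevalZ c F A : peval (c *: F) A = c * peval F A.
Proof. exact: mevalZ. Qed.

Lemma peval0 A : peval (0 : polyring W) A = 0.
Proof. exact: meval0. Qed.

(** Both sides are derivations in F along the ring morphism F |-> F(A + t B), so
it suffices to compare them on constants and coordinates. *)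
Lemma deriv_line_poly F A B :
  (line_poly F A B)^`() = line_poly (dirderiv B F) A B.
Proof.
pose h i : {poly R} := (coords A 0 i)%:P + coords B 0 i *: 'X.
pose L : polyring W -> {poly R} := mmap (@polyC R) h.
pose P G := (L G)^`() = L (dirderiv B G).
have PD G1 G2 : P G1 -> P G2 -> P (G1 + G2).
  by rewrite /P /L !dirderivDr !mmapD derivD => -> ->.
have PM G1 G2 : P G1 -> P G2 -> P (G1 * G2).
  by rewrite /P /L !dirderivM mmapD !rmorphM /= derivM => -> ->.
have PC c : P (mpolyC _ c).
  rewrite /P /L mmapC derivC dirderiv_homog0 ?mmap0 //.
  apply/dhomogP => m; rewrite msuppC; case: ifP => // _.
  by rewrite inE => /eqP ->; exact: mdeg0.
have PX i : P (mpolyX R (mnm1 i)).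
  rewrite /P /L mmapX mmap1U /h derivD derivC derivZ derivX add0r.
  rewrite /dirderiv raddf_sum (bigD1 i) //= big1 ?addr0 => [|j ji].
    rewrite mderivX mmapZ mmapZ mnm1E eqxx mmapX.
    rewrite (_ : mnm_sub _ _ = mnm0) ?mmap11 -?mul_polyC; first by rewrite !mulr1.
    by apply/mnmP => k; rewrite mnmBE subnn mnm0E.
  by rewrite mderivX mnm1E eq_sym (negPf ji) scale0r scaler0 mmap0.
have P1 m : P (mpolyX R m).
  rewrite mpolyXE_id; elim/big_ind: _ => [||i _]; [exact: (PC 1)|exact: PM|].
  elim: (m i) => [|k IH]; first exact: (PC 1).
  by rewrite exprS; apply: PM.
suff: P F by [].
elim/mpolyind: F => [|c m F _ _ IH].
  by rewrite -(mpolyC0 _ R); apply: PC.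
by apply: PD => //; rewrite -mul_mpolyC; apply: PM.
Qed.

(** Euler's identity: the derivative at t = 1 of F(t B) = t^d F(B). *)
Lemma peval_dirderiv d B F :
  phomogeneous d F -> peval (dirderiv B F) B = d%:R * peval F B.
Proof.
move=> hF.
have E : line_poly F 0 B = peval F B *: 'X^d.
  rewrite /line_poly /peval /mmap mevalE scaler_suml; apply: eq_big_seq => m mF.
  rewrite -mul_polyC polyCM -mulrA; congr (_ * _).
  rewrite -(dhomog_mf hF mF) /= mdegE expr_sum rmorph_prod -big_split /=.
  apply: eq_bigr => i _.
  by rewrite [X in X%:P]mxE linear0 add0r -mul_polyC exprMn rmorphXn.
have := congr1 (fun p => p.[1]) (deriv_line_poly F 0 B).
rewrite E line_polyE scale1r add0r => <-.
by rewrite derivZ derivXn hornerZ hornerMn hornerXn expr1n mulrC.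
Qed.

End Calculus.

(** * Connected components *)

Section Components.
Local Open Scope classical_set_scope.
Variables (R : realType) (W : vectType R).
Implicit Types (S C : set W) (x y : W).

Lemma coords_inj : injective (@coords R W).
Proof.
move=> x y /rowP xy; rewrite (coord_vbasis (memvf x)) (coord_vbasis (memvf y)).
by apply: eq_bigr => i _; have := xy i; rewrite !mxE => ->.
Qed.

Lemma component_sub S C : is_component S C -> C `<=` S.
Proof.
case=> w _ -> x /connected_component_sub [y Sy /coords_inj <-]; exact: Sy.
Qed.

Lemma component_nonempty S C : is_component S C -> exists x, C x.
Proof.
by case=> w Sw ->; exists w; apply: connected_component_refl; exists w.
Qed.

(** The way components are used below: a segment inside S cannot leave the
component in which it starts. *)
Lemma component_segment S C x y : is_component S C -> C x ->
  (forall t, 0 <= t <= 1 -> S (x + t *: (y - x))) -> C y.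
Proof.
case=> w _ -> /= Cx Sxy.
have line t : coords (x + t *: (y - x)) = coords x + t *: coords (y - x).
  by apply/rowP => i; rewrite !mxE linearD linearZ.
rewrite (same_connected_component Cx).
have -> : coords y = coords (x + 1 *: (y - x)) by rewrite scale1r subrKC.
pose f (t : R) := coords x + t *: coords (y - x).
have If t : `[0, 1]%classic t -> (f @` `[0, 1]) (coords (x + t *: (y - x))).
  by move=> t01; exists t => //; rewrite line.
apply: (@connected_component_max _ _ (f @` `[0, 1])).
- rewrite -[x in coords x]addr0 -(scale0r (y - x)).
  by apply: If; rewrite /= in_itv /= lexx ler01.
- move=> _ [t /= t01 <-]; rewrite /f -line; exists (x + t *: (y - x)) => //.
  by apply: Sxy; move: t01; rewrite in_itv.
- apply: connected_continuous_connected; first exact: segment_connected.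
  apply: continuous_subspaceT => t; rewrite /f.
  apply: cvgD; first exact: cvg_cst.
  by apply: cvgZr_tmp; exact: cvg_id.
- by apply: If; rewrite /= in_itv /= lexx ler01.
Qed.
End Components.

(** * Derivatives of homogeneous Garding polynomials *)

Section Garding.
Local Open Scope classical_set_scope.
Variables (R : realType) (W : vectType R) (K : set W) (e : W).
Hypothesis KZ : forall c A, 0 <= c -> K A -> K (c *: A).
Hypothesis Ke : forall A, exists2 c, 0 < c & K (c *: e - A).
Implicit Types (F : polyring W) (A B P : W).

Hypothesis KD : forall A B, K A -> K B -> K (A + B).

Definition garding_form d F := phomogeneous d F /\ garding K F.

Local Notation D P k F := (iter k (dirderiv P) F).
Local Notation C := (conic_component K).

Lemma conic_componentP F : garding K F -> is_conic_component K F (C F).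
Proof. by case=> _ /getPex. Qed.

Lemma garding_neq0 F : garding K F -> F != 0.
Proof. by case. Qed.

Lemma order_unit_cone : K e.
Proof.
have [c c0] := Ke 0; rewrite subr0 => /(KZ (c := c^-1)).
by rewrite scalerA mulVf ?gt_eqF // scale1r; apply; rewrite invr_ge0 ltW.
Qed.

Lemma pdegree_homog d F : F != 0 -> phomogeneous d F -> pdegree F = d.
Proof.
move=> F0 hF; apply: (dhomog_uniq F0 _ hF); exact: dhomog_msize hF.
Qed.

Lemma garding_form_dirderiv_sub d F P : garding_form d F -> K P ->
  dirderiv P F != 0 ->
  garding_form d.-1 (dirderiv P F) /\ C F `<=` C (dirderiv P F).
Proof.
move=> [hF gF] KP dF.
have d1 : (1 <= pdegree F)%N.
  rewrite (pdegree_homog (garding_neq0 gF) hF) lt0n.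
  by apply: contraNneq dF => d0; rewrite dirderiv_homog0 // -d0.
by case: gF => _ _ /(_ d1 P KP dF) g /(_ d1 P KP dF) sub;
  split=> //; split=> //; apply: dirderiv_homog.
Qed.

Lemma garding_form_dirderiv d F P : garding_form d F -> K P ->
  dirderiv P F != 0 -> garding_form d.-1 (dirderiv P F).
Proof. by move=> gF KP dF; case: (garding_form_dirderiv_sub gF KP dF). Qed.

(** Homogeneity transports positivity along the ray; a point of the ray lies in
the component because s e - u is in K for any u and all large s. *)
Lemma conic_component_ray d F s : garding_form d F -> 0 < s -> C F (s *: e).
Proof.
move=> [hF gF] s0; have [comp ray] := conic_componentP gF.
have [u Cu] := component_nonempty comp; have [c c0 Kcu] := Ke u.
have Cc : C F (c *: e) by rewrite -(subrK u (c *: e)) addrC; apply: ray.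
have Fe : 0 < peval F e.
  have : 0 < peval F (c *: e) := component_sub comp Cc.
  by rewrite (peval_scale _ _ hF) pmulr_rgt0 // exprn_gt0.
apply: (component_segment comp Cc) => t /andP[t0 t1].
rewrite -scalerBl scalerA -scalerDl.
rewrite /positivity_set /= (peval_scale _ _ hF) pmulr_rgt0 // exprn_gt0 //.
have -> : c + t * (s - c) = (1 - t) * c + t * s by ring.
have [->|tn0] := eqVneq t 0; first by rewrite mul0r addr0 subr0 mul1r.
apply: ltr_wpDl; first by rewrite mulr_ge0 ?subr_ge0 // ltW.
by rewrite mulr_gt0 // lt_def tn0.
Qed.

Lemma peval_order_unit_gt0 d F : garding_form d F -> 0 < peval F e.
Proof.
move=> gF; have := conic_component_ray gF ltr01; rewrite scale1r.
exact: (component_sub (conic_componentP gF.2).1).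
Qed.

(** B + s e is in the component for every s > 0; the point s = 0 is then reached
along a segment on which F stays positive. *)
Lemma conic_component_cone d F B :
  garding_form d F -> K B -> 0 < peval F B -> C F B.
Proof.
move=> gF KB FB; have [comp ray] := conic_componentP gF.2.
have CB s : 0 < s -> C F (s *: e + B).
  by move=> s0; apply: ray => //; apply: conic_component_ray gF s0.
apply: (component_segment comp (CB 1 ltr01)) => t /andP[t0 t1].
have -> : 1 *: e + B + t *: (B - (1 *: e + B)) = (1 - t) *: e + B.
  by rewrite opprD addrCA subrr addr0 scale1r scalerN scalerBl scale1r addrAC.
have [->|tn1] := eqVneq t 1; first by rewrite subrr scale0r add0r.
by apply: (component_sub comp); apply: CB; rewrite subr_gt0 lt_neqAle tn1.
Qed.

Lemma peval_dirderiv_gt0 d F A B : garding_form d F -> K A -> K B ->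
  0 < peval F B -> dirderiv A F != 0 -> 0 < peval (dirderiv A F) B.
Proof.
move=> gF KA KB FB dF; have [gdF sub] := garding_form_dirderiv_sub gF KA dF.
apply: (component_sub (conic_componentP gdF.2).1); apply: sub.
exact: conic_component_cone gF KB FB.
Qed.

Lemma peval_dirderiv_ge0 d F P : garding_form d F -> K P ->
  0 <= peval (dirderiv P F) e.
Proof.
move=> gF KP; have [->|dF] := eqVneq (dirderiv P F) 0; first by rewrite peval0.
exact/ltW/peval_order_unit_gt0/(garding_form_dirderiv gF KP dF).
Qed.

(** At e, the derivative along c B is that along P, which is positive, plus that
along c B - P, which is nonnegative. *)
Lemma dirderiv_dominated d F P B c : garding_form d F -> K P ->
  K (c *: B - P) -> dirderiv P F != 0 -> dirderiv B F != 0.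
Proof.
move=> gF KP KBP dF.
have : 0 < peval (dirderiv (c *: B) F) e.
  rewrite -(subrK P (c *: B)) dirderivDl pevalD ltr_wpDl //.
    exact: peval_dirderiv_ge0 gF KBP.
  exact: peval_order_unit_gt0 (garding_form_dirderiv gF KP dF).
rewrite dirderivZl pevalZ; apply: contraTneq => ->.
by rewrite peval0 mulr0 ltxx.
Qed.

Lemma iter_dirderiv0 P k : D P k (0 : polyring W) = 0.
Proof. by elim: k => //= k ->; rewrite dirderiv0. Qed.

Lemma iter_dirderivDr P k F G : D P k (F + G) = D P k F + D P k G.
Proof. by elim: k => //= k ->; rewrite dirderivDr. Qed.

Lemma iter_dirderiv_dirderiv P B k F :
  D P k (dirderiv B F) = dirderiv B (D P k F).
Proof. by elim: k => //= k ->; rewrite dirderivC. Qed.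

Lemma iter_dirderivC P B k l F : D P k (D B l F) = D B l (D P k F).
Proof. by elim: l => //= l <-; rewrite iter_dirderiv_dirderiv. Qed.

Lemma garding_form_iter d F P k : garding_form d F -> K P ->
  D P k F != 0 -> (k <= d)%N /\ garding_form (d - k) (D P k F).
Proof.
move=> gF KP; elim: k => [|k IH] /= dF; first by rewrite subn0.
have kF : D P k F != 0 by apply: contraNneq dF => ->; rewrite dirderiv0.
have [kd gk] := IH kF; split; last first.
  by rewrite subnS; apply: garding_form_dirderiv.
rewrite ltn_neqAle kd andbT; apply: contraNneq dF => kd'.
by rewrite dirderiv_homog0 //; move: gk.1; rewrite kd' subnn.
Qed.

Lemma iter_dirderiv_dominated d F P B c k : garding_form d F -> K P -> K B ->
  K (c *: B - P) -> D P k F != 0 -> D B k F != 0.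
Proof.
move=> gF KP KB KBP; elim: k d F gF => [|k IH] d F gF //=.
rewrite -iterS iterSr => dF.
have d1 : dirderiv P F != 0.
  by apply: contraNneq dF => ->; rewrite iter_dirderiv0.
have := IH _ _ (garding_form_dirderiv gF KP d1) dF.
rewrite iter_dirderiv_dirderiv => dPF.
have [|_ gB] := garding_form_iter (k := k) gF KB.
  by apply: contraNneq dPF => ->; rewrite dirderiv0.
exact: dirderiv_dominated gB KP KBP dPF.
Qed.

(** The coefficient of t^k in F(e + t P) is D_P^k F at e up to a positive factor,
and vanishes only if D_P^k F is zero. *)
Lemma size_line_poly d F P k : garding_form d F -> K P ->
  (k < size (line_poly F e P))%N = (D P k F != 0).
Proof.
move=> gF KP; elim: k d F gF => [|k IH] d F gF.
  rewrite size_poly_gt0 /= (garding_neq0 gF.2).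
  apply/eqP => /(congr1 (fun p => p.[0])).
  rewrite line_polyE scale0r addr0 horner0 => /eqP.
  by rewrite gt_eqF // (peval_order_unit_gt0 gF).
rewrite iterSr -[LHS]/((k.+2 <= _)%N) -ltn_predRL -size_deriv deriv_line_poly.
have [->|dF0] := eqVneq (dirderiv P F) 0.
  rewrite iter_dirderiv0 eqxx; apply/negbTE.
  by rewrite /line_poly mmap0 size_poly0.
exact: IH (garding_form_dirderiv gF KP dF0).
Qed.

(** By Euler's identity F(B) is the constant D_B^d F divided by d!. *)
Lemma peval_gt0_of_iter d F B : garding_form d F -> K B ->
  D B d F != 0 -> 0 < peval F B.
Proof.
move=> gF KB; elim: d F gF => [|d IH] F gF.
  by rewrite (peval_homog0 B e gF.1) (peval_order_unit_gt0 gF).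
rewrite iterSr => dF.
have d1 : dirderiv B F != 0.
  by apply: contraNneq dF => ->; rewrite iter_dirderiv0.
have := IH _ (garding_form_dirderiv gF KB d1) dF.
by rewrite (peval_dirderiv _ gF.1) pmulr_rgt0 // ltr0Sn.
Qed.

Lemma iter_dirderiv_neq0 d F B k : phomogeneous d F -> peval F B != 0 ->
  (k <= d)%N -> D B k F != 0.
Proof.
elim: k d F => [|k IH] d F hF FB kd.
  by apply: contraNneq FB => /= ->; rewrite peval0.
rewrite iterSr; apply: (IH d.-1); first exact: dirderiv_homog.
  by rewrite (peval_dirderiv _ hF) mulf_neq0 // pnatr_eq0 -lt0n (leq_trans _ kd).
by rewrite -ltnS (ltn_predK kd).
Qed.

(** Submodularity rests on this step: B is a point of the component of a suitable
derivative of F along e, so the derivative along A is positive there. *)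
Lemma dirderiv_exchange d F A B n : garding_form d F -> K A -> K B ->
  dirderiv A F != 0 -> D B n.+1 F != 0 -> D B n (dirderiv A F) != 0.
Proof.
move=> gF KA KB dA dB; have [nd gB] := garding_form_iter gF KB dB.
have gA := garding_form_dirderiv gF KA dA.
(* After k derivatives along e the degree is n + 1; nothing nonzero is lost,
   since the forms involved are positive at e. *)
pose k := (d - n.+1)%N.
have Dk d' G : garding_form d' G -> (k <= d')%N -> D e k G != 0.
  move=> gG; apply: iter_dirderiv_neq0 gG.1 _.
  by rewrite gt_eqF // (peval_order_unit_gt0 gG).
have [|_ gG] := garding_form_iter (k := k) gF order_unit_cone.
  by apply: Dk gF _; rewrite leq_subr.
rewrite subKn // in gG; set G := D e k F in gG.
have GA : dirderiv A G != 0.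
  rewrite -iter_dirderiv_dirderiv; apply: Dk gA _.
  by rewrite /k subnS -!subn1 leq_sub2r // leq_subr.
have GB : 0 < peval G B.
  apply: peval_gt0_of_iter gG KB _; rewrite iter_dirderivC.
  exact: Dk gB _.
have GAB : D B n (dirderiv A G) != 0.
  apply: iter_dirderiv_neq0 (dirderiv_homog A gG.1) _ _ => //.
  by rewrite gt_eqF // (peval_dirderiv_gt0 gG).
apply: contraNneq GAB.
by rewrite -iter_dirderiv_dirderiv iter_dirderivC => ->; rewrite iter_dirderiv0.
Qed.

Lemma iter_dirderiv_exchange d F A B m n : garding_form d F -> K A -> K B ->
  (m <= n)%N -> D A m F != 0 -> D B n F != 0 -> D B (n - m) (D A m F) != 0.
Proof.
move=> gF KA KB; elim: m n d F gF => [|m IH] [|n] d F gF //= mn.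
rewrite -!iterS !iterSr => dA dB.
have d1 : dirderiv A F != 0.
  by apply: contraNneq dA => ->; rewrite iter_dirderiv0.
rewrite subSS; apply: IH (garding_form_dirderiv gF KA d1) _ dA _ => //.
by apply: dirderiv_exchange gF KA KB d1 _; rewrite iterSr.
Qed.

Lemma iter_dirderivD_neq0 A B n F : D (A + B) n F != 0 ->
  exists j k, (j + k = n)%N /\ D A j (D B k F) != 0.
Proof.
elim: n F => [|n IH] F; first by exists 0%N, 0%N.
rewrite iterSr dirderivDl => dF.
have : D (A + B) n (dirderiv A F) != 0 \/ D (A + B) n (dirderiv B F) != 0.
  apply/orP; rewrite -negb_and; apply: contraNN dF => /andP[/eqP dA /eqP dB].
  by rewrite iter_dirderivDr dA dB addr0.
case=> /IH [j [k [<- dF']]].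
  exists j.+1, k; split=> //; move: dF'.
  by rewrite iter_dirderiv_dirderiv iterSr !iter_dirderiv_dirderiv.
exists j, k.+1; split; first by rewrite addnS.
by rewrite iterSr.
Qed.

Lemma size_line_poly_gt0 d F P : garding_form d F -> K P ->
  (0 < size (line_poly F e P))%N.
Proof. by move=> gF KP; rewrite (size_line_poly _ gF KP) (garding_neq0 gF.2). Qed.

Lemma size_line_poly_dominated d F P B c : garding_form d F -> K P -> K B ->
  K (c *: B - P) -> (size (line_poly F e P) <= size (line_poly F e B))%N.
Proof.
move=> gF KP KB KBP; have := size_line_poly_gt0 gF KP.
case E: (size _) => [//|k] _; rewrite (size_line_poly _ gF KB).
by apply: (iter_dirderiv_dominated gF KP KB KBP); rewrite -(size_line_poly _ gF KP) E.
Qed.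

(** A, T, B, S play the roles of the projections onto the intersection, the sum
and the two subspaces; only their comparisons in the cone order matter. *)
Lemma size_line_poly_submod d F A B S T c : garding_form d F ->
    K A -> K B -> K S -> K T -> K (B - A) -> K (S - A) -> K (T - A) ->
    K (c *: (B + S) - T) ->
  (size (line_poly F e A) + size (line_poly F e T) <=
   size (line_poly F e B) + size (line_poly F e S))%N.
Proof.
move=> gF KA KB KS KT KBA KSA KTA KBST.
have KBS := KD KB KS.
have mn : (size (line_poly F e A) <= size (line_poly F e T))%N.
  by apply: (size_line_poly_dominated (c := 1) gF KA KT); rewrite scale1r.
move: mn (size_line_poly_gt0 gF KA).
case Em: (size (line_poly F e A)) => [//|m].
case En: (size (line_poly F e T)) => [//|n] mn _.
have dA : D A m F != 0 by rewrite -(size_line_poly _ gF KA) Em.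
have dT : D T n F != 0 by rewrite -(size_line_poly _ gF KT) En.
have dBS := iter_dirderiv_dominated gF KT KBS KBST dT.
have := iter_dirderiv_exchange gF KA KBS (mn : (m <= n)%N) dA dBS.
move=> /iter_dirderivD_neq0 [j [k [jk djk]]].
have bound X l : K X -> K (X - A) -> D X l (D A m F) != 0 ->
    (m + l < size (line_poly F e X))%N.
  move=> KX KXA; rewrite iter_dirderivC (size_line_poly _ gF KX) iterD => dX.
  have [|_ gX] := garding_form_iter (k := l) gF KX.
    by apply: contraNneq dX => ->; rewrite iter_dirderiv0.
  by apply: (iter_dirderiv_dominated (c := 1) gX KA KX) dX; rewrite scale1r.
have jB : (m + j < size (line_poly F e B))%N.
  apply: bound => //; apply: contraNneq djk => dj.
  by rewrite (iter_dirderivC B S) dj iter_dirderiv0.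
have kS : (m + k < size (line_poly F e S))%N.
  apply: bound => //; apply: contraNneq djk => ->.
  by rewrite iter_dirderiv0.
have := leq_add jB kS.
have -> : ((m + j).+1 + (m + k).+1 = m.+1 + n.+1)%N by lia.
by [].
Qed.

End Garding.

(** * The cone of semipositive Hermitian forms *)

Section RealForm.
Variables (R : realType) (V : vectType R[i]) (rho : {dot V for @Num.conj R[i]}).
Implicit Types (x y z u v : V) (U W : {vspace V}) (A B T : Q rho) (a : R[i]) (c : R).

(** The Euclidean inner product underlying rho. *)
Definition re x y : R := complex.Re (rho x y).

Lemma reDl x y z : re (x + y) z = re x z + re y z.
Proof. by rewrite /re linearDl raddfD. Qed.

Lemma reDr x y z : re x (y + z) = re x y + re x z.
Proof. by rewrite /re linearDr raddfD. Qed.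

Lemma reBl x y z : re (x - y) z = re x z - re y z.
Proof. by rewrite /re linearBl raddfB. Qed.

Lemma reBr x y z : re x (y - z) = re x y - re x z.
Proof. by rewrite /re linearBr raddfB. Qed.

Lemma reZl c x y : re ((c%:C)%C *: x) y = c * re x y.
Proof.
by rewrite /re linearZl_LR /=; case: (rho x y) => ? ? /=; rewrite mul0r subr0.
Qed.

Lemma rho_conj x y : rho x y = (rho y x)^*.
Proof. by rewrite hermC expr0 mul1r. Qed.

Lemma reC x y : re x y = re y x.
Proof. by rewrite /re rho_conj; case: (rho y x). Qed.

Lemma reZr c x y : re x ((c%:C)%C *: y) = c * re x y.
Proof. by rewrite reC reZl reC. Qed.

Lemma re_ge0 x : 0 <= re x x.
Proof. by have := dnorm_ge0 rho x; rewrite lecE => /andP[]. Qed.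

Lemma rho_diag x : rho x x = ((re x x)%:C)%C.
Proof.
by have := dnorm_ge0 rho x; rewrite /re lecE; case: (rho x x) => s t /= /andP[/eqP ->].
Qed.

Lemma re_eq0 x : re x x = 0 -> x = 0.
Proof. by move=> x0; apply/eqP; rewrite -(dnorm_eq0 rho) rho_diag x0. Qed.

Lemma re_scale a : exists2 N : R, 0 <= N & forall x, re (a *: x) (a *: x) = N * re x x.
Proof.
have : 0 <= `|a| ^+ 2 by rewrite exprn_ge0.
rewrite lecE; case E: (`|a| ^+ 2) => [N t] /= /andP[/eqP t0 N0]; exists N => // x.
rewrite [LHS]/re dnormZ E rho_diag t0 /=; ring.
Qed.

Lemma re_double x y : re (x + y) (x + y) <= 2 * re x x + 2 * re y y.
Proof.
have := re_ge0 (x - y); rewrite !(reBl, reBr, reDl, reDr) (reC y x); lra.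
Qed.

Lemma orthoproj_mem U x : orthoproj rho U x \in U.
Proof. exact: memv_pi. Qed.

Lemma rho_orthoproj U x u : u \in U -> rho (orthoproj rho U x) u = rho x u.
Proof.
move=> uU; have dec : orthoproj rho U x + daddv_pi (orthov rho U) U x = x.
  by apply: daddv_pi_add; rewrite ?capv_orthov // addv_orthov memvf.
rewrite -[in RHS]dec linearDl /= [X in _ = _ + X](_ : _ = 0) ?addr0 //.
have /mem_orthovP h := memv_pi (orthov rho U) U x; exact: h.
Qed.

Lemma re_orthoproj U x u : u \in U -> re (orthoproj rho U x) u = re x u.
Proof. by move=> uU; rewrite /re rho_orthoproj. Qed.

(** Boundedness of linear maps in finite dimension, obtained by adding one vector
at a time, made orthogonal to the span of the previous ones. *)
Lemma End_bounded (g : 'End(V)) :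
  exists2 c, 0 <= c & forall y, re (g y) (g y) <= c * re y y.
Proof.
suff [c c0 cP] : exists2 c, 0 <= c &
    forall y, y \in span (vbasis {:V}) -> re (g y) (g y) <= c * re y y.
  by exists c => // y; apply: cP; rewrite (span_basis (vbasisP _)) memvf.
elim: (tval (vbasis {:V})) => [|v s [c c0 cP]].
  exists 0 => // y; rewrite span_nil memv0 => /eqP ->.
  by rewrite linear0 /re linear0l mul0r.
set U := span s in cP; pose v' := v - orthoproj rho U v.
have v'U u : u \in U -> rho v' u = 0.
  by move=> uU; rewrite linearBl /= rho_orthoproj // subrr.
have [k k0 kP] : exists2 k : R, 0 <= k & re (g v') (g v') <= k * re v' v'.
  have [v0|v0] := eqVneq (re v' v') 0.
    by exists 0 => //; rewrite (re_eq0 v0) linear0 /re linear0l mul0r.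
  exists (re (g v') (g v') / re v' v'); last by rewrite divfK.
  by rewrite divr_ge0 ?re_ge0.
exists (2 * k + 2 * c) => [|y]; first lra.
rewrite span_cons => /memv_addP [_ /vlineP [a ->] [u uU ->]].
pose u' := u + a *: orthoproj rho U v.
have u'U : u' \in U by rewrite rpredD // rpredZ // orthoproj_mem.
have -> : a *: v + u = a *: v' + u'.
  by rewrite /u' /v' scalerBr [u + _]addrC addrA subrK.
clearbody v' u'; have [N N0 NE] := re_scale a.
have -> : re (a *: v' + u') (a *: v' + u') = N * re v' v' + re u' u'.
  have z : re (a *: v') u' = 0 by rewrite /re linearZl_LR /= v'U // mulr0.
  by rewrite reDl !reDr (reC u' (a *: _)) z NE addr0 add0r.
rewrite linearD linearZ.
apply: le_trans (re_double _ _) _; rewrite NE.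
have := ler_wpM2l N0 kP; have := cP _ u'U; have := re_ge0 v'; have := re_ge0 u'.
move=> h1 h2 h3 h4.
have := mulr_ge0 N0 h2 => h5; have := mulr_ge0 c0 h5 => h6.
have := mulr_ge0 k0 h1 => h7.
nra.
Qed.

Lemma Q_endoD A B x : Q_endo (A + B) x = Q_endo A x + Q_endo B x.
Proof. by rewrite /Q_endo raddfD; exact: add_lfunE. Qed.

Lemma Q_endoB A B x : Q_endo (A - B) x = Q_endo A x - Q_endo B x.
Proof. by rewrite Q_endoD; congr (_ + _); rewrite /Q_endo raddfN; exact: opp_lfunE. Qed.

Lemma Q_endoZ c A x : Q_endo (c *: A) x = (c%:C)%C *: Q_endo A x.
Proof. by rewrite /Q_endo linearZ; exact: scale_lfunE. Qed.

Lemma Q_endo_selfadjoint A : selfadjoint rho (Q_endo A).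
Proof. by apply/mem_herm_space; exact: valP. Qed.

Lemma QplusP A : Qplus A <-> forall x, 0 <= re (Q_endo A x) x.
Proof.
split=> h x; have := h x; first by rewrite lecE => /andP[].
move=> r0; rewrite lecE r0 andbT /=; apply/eqP.
have := rho_conj (Q_endo A x) x; rewrite -Q_endo_selfadjoint.
case: (rho _ _) => s t [] /=; lra.
Qed.

Lemma Qplus_scale c A : 0 <= c -> Qplus A -> Qplus (c *: A).
Proof.
move=> c0 /QplusP h; apply/QplusP => x.
by rewrite Q_endoZ reZl mulr_ge0.
Qed.

Lemma Qplus_add A B : Qplus A -> Qplus B -> Qplus (A + B).
Proof.
move=> /QplusP hA /QplusP hB; apply/QplusP => x.
by rewrite Q_endoD reDl addr_ge0.
Qed.

(** 2 (A x, x) <= |A x|^2 + |x|^2, and A is bounded. *)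
Lemma Qplus_order_unit A : exists2 c, 0 < c & Qplus (c *: QI rho - A).
Proof.
have [c c0 cP] := End_bounded (Q_endo A); exists (c + 1); first lra.
apply/QplusP => x; rewrite Q_endoB Q_endoZ reBl reZl.
rewrite /Q_endo /= id_lfunE -/(Q_endo A).
have := re_ge0 (x - Q_endo A x); rewrite !(reBl, reBr) (reC x).
have := cP x; have := re_ge0 x; have := re_ge0 (Q_endo A x).
have := mulr_ge0 c0 (re_ge0 x).
lra.
Qed.

(** Encodes that A is the projection onto U through its quadratic form |p|^2,
which is all that the order on forms sees; the projection p of x is determined by
its inner products with U. *)
Definition projection_form A U : Prop := forall x, exists p,
  [/\ p \in U, forall u, u \in U -> re p u = re x u &
      re (Q_endo A x) x = re p p].

Lemma QpiP U : projection_form (Qpi rho U) U.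
Proof.
move=> x; exists (orthoproj rho U x); split; first exact: orthoproj_mem.
  by move=> u; apply: re_orthoproj.
by rewrite (re_orthoproj _ (orthoproj_mem U x)) reC.
Qed.

Lemma Qpi0 : Qpi rho 0 = 0.
Proof.
apply/val_inj/lfunP => x /=; rewrite zero_lfunE.
by apply/eqP; rewrite -memv0; apply: (orthoproj_mem 0).
Qed.

Lemma Qplus_Qpi U : Qplus (Qpi rho U).
Proof. by apply/QplusP => x; have [p [_ _ ->]] := QpiP U x; apply: re_ge0. Qed.

Lemma projection_form_mono A B U W : projection_form A U ->
  projection_form B W -> (U <= W)%VS -> Qplus (B - A).
Proof.
move=> AU BW UW; apply/QplusP => x; rewrite Q_endoB reBl.
have [p [pU pE ->]] := AU x; have [q [_ qE ->]] := BW x.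
have pq : re q p = re p p by rewrite qE ?(subvP UW) // -pE.
have := re_ge0 (q - p); rewrite !(reBl, reBr) (reC p) pq; lra.
Qed.

(** For y the projection of x on U + W, write y = u + w; then
|y|^2 = (p, u) + (q, w) with p, q the projections of x on U and W.  Bounding u and
w by y, the inequality of arithmetic and geometric means does the rest. *)
Lemma projection_form_add A B T U W : projection_form A U ->
    projection_form B W -> projection_form T (U + W)%VS ->
  exists c, Qplus (c *: (A + B) - T).
Proof.
move=> AU BW TUW.
have [f [g [fU gW fg]]] : exists f g : 'End(V),
    [/\ forall y, f y \in U, forall y, g y \in W &
        forall y, y \in (U + W)%VS -> f y + g y = y].
  exists (addv_pi1 U W), (addv_pi2 U W).
  by split=> y; [apply: memv_pi1 | apply: memv_pi2 | apply: addv_pi1_pi2].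
have [c1 c10 c1P] := End_bounded f; have [c2 c20 c2P] := End_bounded g.
pose s := c1 + c2 + 1; exists s; apply/QplusP => x.
rewrite Q_endoB Q_endoZ Q_endoD reBl reZl reDl.
have [y [yUW yE ->]] := TUW x.
have [p [_ pE ->]] := AU x; have [q [_ qE ->]] := BW x.
move: (c1P y) (c2P y) (fU y) (gW y) (fg y yUW).
move: (f y) (g y) => u w h1 h2 uU wW uw.
have yy : re y y = re p u + re q w.
  by rewrite yE // -[in LHS]uw reDr pE // qE.
have := re_ge0 ((s%:C)%C *: p - u); have := re_ge0 ((s%:C)%C *: q - w).
rewrite !(reBl, reBr, reZl, reZr) (reC u) (reC w) => h3 h4.
have s0 : 0 < s by rewrite /s; lra.
rewrite subr_ge0 -(ler_pM2l s0).
have := re_ge0 y; have sE : s = c1 + c2 + 1 by [].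
clearbody s; nra.
Qed.

Lemma Qplus_QpiB U W : (U <= W)%VS -> Qplus (Qpi rho W - Qpi rho U).
Proof. exact: projection_form_mono (QpiP U) (QpiP W). Qed.

Lemma Qpi_add_dominated U W :
  exists c, Qplus (c *: (Qpi rho U + Qpi rho W) - Qpi rho (U + W)%VS).
Proof. exact: projection_form_add (QpiP U) (QpiP W) (QpiP (U + W)). Qed.

End RealForm.

(** * Submodularity of the degree *)

Theorem theorem5p12 (R : realType) (V : vectType R[i])
    (rho : {dot V for @Num.conj R[i]}) (d : nat) (H : polyring (Q rho))
    (hd : (1 <= d)%N) (Hhom : phomogeneous d H) (HG : garding (@Qplus R V rho) H) :
  integral_polymatroid (rank_fun H).
Proof.
have gH : garding_form (@Qplus R V rho) d H by split.
have KZ := @Qplus_scale R V rho; have KD := @Qplus_add R V rho.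
have Ke := @Qplus_order_unit R V rho; have Kpi := @Qplus_Qpi R V rho.
have KB := @Qplus_QpiB R V rho.
have gt0 U := size_line_poly_gt0 Ke gH (Kpi U).
have mono U W : (U <= W)%VS ->
    (size (line_poly H (QI rho) (Qpi rho U)) <=
     size (line_poly H (QI rho) (Qpi rho W)))%N.
  move=> UW; apply: (size_line_poly_dominated (c := 1) Ke gH) => //.
  by rewrite scale1r; apply: KB.
rewrite /rank_fun; split; first split.
- by move=> U; rewrite subr_ge0 ler1n.
- suff -> : size (line_poly H (QI rho) (Qpi rho 0)) = 1%N by rewrite subrr.
  apply/eqP; rewrite eqn_leq gt0 andbT leqNgt.
  rewrite (size_line_poly Ke 1 gH (Kpi _)) /= Qpi0.
  by rewrite -(scale0r (QI rho)) dirderivZl scale0r eqxx.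
- by move=> U W UW; rewrite lerD2r ler_nat mono.
- move=> U W; rewrite addrACA [leRHS]addrACA lerD2r -!natrD ler_nat.
  have [c Kc] := Qpi_add_dominated rho U W.
  apply: (size_line_poly_submod KZ Ke KD gH _ _ _ _ _ _ _ Kc); try exact: Kpi.
  + by apply: KB; rewrite capvSl.
  + by apply: KB; rewrite capvSr.
  + by apply: KB; rewrite (subv_trans (capvSl _ _)) // addvSl.
- by move=> U; rewrite rpredB ?rpred1 ?rpred_nat.
Qed.
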